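(* A Hausdorff topological group $G$ is $H$-closed in the class of Hausdorff quasitopological groups if and only if $G$ is Raĭkov complete.
   Context: A quasitopological group is a group endowed with a topology such that the group operation is separately continuous and the inversion $x\mapsto x^{-1}$ is continuous. A topological group is a quasitopological group whose group operation is (jointly) continuous. A group $G$ is $H$-closed in the class of Hausdorff quasitopological groups if $G$ is a closed subgroup of every Hausdorff quasitopological group $H$ which contains $G$ as a subgroup (algebraically, and with the topology of $G$ equal to the subspace topology inherited from $H$). A topological group $G$ is Raĭkov complete if it is complete with respect to the two-sided uniformity $\mathcal L\vee\mathcal R$, the least upper bound of the left uniformity $\mathcal L$ (with base of entourages $\{(x,y)\colon x^{-1}y\in U\}$) and the right uniformity $\mathcal R$ (with base of entourages $\{(x,y)\colon yx^{-1}\in U\}$), where $U$ runs over a base at the unit of $G$. Equivalently, every fundamental filter on $G$ converges, where a filter $\mathcal F$ on $G$ is fundamental if for each neighbourhood $U$ of the unit there exists $F\in\mathcal F$ such that $FF^{-1}\cup F^{-1}F\subset U$. *)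

(* Defs.v *)
From HB Require Import structures.
From mathcomp Require Import all_boot finmap.
From mathcomp Require Import all_classical.
From mathcomp Require Import topology.

Set Implicit Arguments.
Unset Strict Implicit.
Unset Printing Implicit Defensive.

Local Open Scope classical_set_scope.
Local Open Scope group_scope.

HB.mixin Record isQuasitopologicalGroup G & Group G & Topological G := {
  mulgl_continuous : forall a : G, continuous (fun x : G => a * x);
  mulgr_continuous : forall a : G, continuous (fun x : G => x * a);
  invg_continuous : continuous (fun x : G => x^-1);
}.

#[short(type="quasitopologicalGroupType")]
HB.structure Definition QuasitopologicalGroup :=
  {G of Group G & Topological G & isQuasitopologicalGroup G}.

HB.mixin Record Quasitopological_isTopologicalGroup G
    & QuasitopologicalGroup G := {
  mulg_continuous : continuous (fun xy : G * G => xy.1 * xy.2);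
}.

#[short(type="topologicalGroupType")]
HB.structure Definition TopologicalGroup :=
  {G of QuasitopologicalGroup G & Quasitopological_isTopologicalGroup G}.

(* "H contains G as a subgroup, with the subspace topology" is rendered by an
   injective homomorphism [f : G -> H] such that the open sets of [G] are
   exactly the traces of the open sets of [H]. *)
Definition subgroup_embedding (G H : quasitopologicalGroupType)
    (f : {multiplicative G -> H}) : Prop :=
  injective f /\ @open G = [set f @^-1` V | V in @open H].

Definition Hclosed_quasitopological (G : quasitopologicalGroupType) : Prop :=
  forall (H : quasitopologicalGroupType) (f : {multiplicative G -> H}),
    hausdorff_space H -> subgroup_embedding f -> closed (range f).

Definition left_entourage (G : topologicalGroupType) : set_system (G * G) :=
  filter_from (nbhs (1 : G)) (fun U => [set xy | U (xy.1^-1 * xy.2)]).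

Definition right_entourage (G : topologicalGroupType) : set_system (G * G) :=
  filter_from (nbhs (1 : G)) (fun U => [set xy | U (xy.2 * xy.1^-1)]).

Arguments left_entourage : clear implicits.
Arguments right_entourage : clear implicits.

Section group_uniformities.
Variable G : topologicalGroupType.
Implicit Types x y : G.

Let nbhs1V (U : set G) : nbhs (1 : G) U -> nbhs (1 : G) [set x | U x^-1].
Proof. by move=> U1; apply: (@invg_continuous G 1 U); rewrite /= invg1. Qed.

Let nbhs1M (U : set G) : nbhs (1 : G) U ->
  exists2 V, nbhs (1 : G) V & forall x y, V x -> V y -> U (x * y).
Proof.
move=> U1; have := @mulg_continuous G (1, 1) U.
rewrite /= mulg1 => /(_ U1) [[V W] /= [V1 W1] VWU].
exists (V `&` W); first exact: filterI.
by move=> x y [Vx _] [_ Wy]; exact: (VWU (x, y)).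
Qed.

Lemma left_entourage_filter : Filter (left_entourage G).
Proof.
apply: filter_from_filter; first by exists setT; exact: filterT.
by move=> U V U1 V1; exists (U `&` V); [exact: filterI|].
Qed.

Lemma left_entourage_refl A : left_entourage G A -> diagonal `<=` A.
Proof.
move=> [U U1 UA] [x y] /diagonalP ->; apply: UA => /=.
by rewrite mulVg; exact: nbhs_singleton.
Qed.

Lemma left_entourage_inv A : left_entourage G A -> left_entourage G A^-1%relation.
Proof.
move=> [U U1 UA]; exists [set x | U x^-1]; first exact: nbhs1V.
by move=> [x y] /=; rewrite invgM invgK => /(UA (y, x)).
Qed.

Lemma left_entourage_split A : left_entourage G A ->
  exists2 B, left_entourage G B & (B \; B `<=` A)%relation.
Proof.
move=> [U U1 UA]; have [V V1 VVU] := nbhs1M U1.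
exists [set xy | V (xy.1^-1 * xy.2)]; first by exists V.
move=> [x y] [z /= Vxz Vzy]; apply: UA => /=.
by rewrite -[y](mulVKg z) mulgA; exact: VVU.
Qed.

Lemma left_entourage_nbhs : @nbhs G G = nbhs_ (left_entourage G).
Proof.
rewrite predeq2E => x A; split=> [Ax|[E [U U1 UE] EA]].
  exists [set xy | A (x * (xy.1^-1 * xy.2))]; last first.
    by move=> y /xsectionP /=; rewrite mulVKg.
  exists [set y | A (x * y)] => //.
  by apply: (@mulgl_continuous G x 1 A); rewrite /= mulg1.
apply: (filterS EA); apply: (@filterS _ _ _ [set y | U (x^-1 * y)]).
  by move=> y Uy; apply/xsectionP/(UE (x, y)).
by apply: (@mulgl_continuous G x^-1 x U); rewrite /= mulVg.
Qed.

Lemma right_entourage_filter : Filter (right_entourage G).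
Proof.
apply: filter_from_filter; first by exists setT; exact: filterT.
by move=> U V U1 V1; exists (U `&` V); [exact: filterI|].
Qed.

Lemma right_entourage_refl A : right_entourage G A -> diagonal `<=` A.
Proof.
move=> [U U1 UA] [x y] /diagonalP ->; apply: UA => /=.
by rewrite mulgV; exact: nbhs_singleton.
Qed.

Lemma right_entourage_inv A :
  right_entourage G A -> right_entourage G A^-1%relation.
Proof.
move=> [U U1 UA]; exists [set x | U x^-1]; first exact: nbhs1V.
by move=> [x y] /=; rewrite invgM invgK => /(UA (y, x)).
Qed.

Lemma right_entourage_split A : right_entourage G A ->
  exists2 B, right_entourage G B & (B \; B `<=` A)%relation.
Proof.
move=> [U U1 UA]; have [V V1 VVU] := nbhs1M U1.
exists [set xy | V (xy.2 * xy.1^-1)]; first by exists V.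
move=> [x y] [z /= Vxz Vzy]; apply: UA => /=.
by rewrite -[y](mulgVK z) -mulgA; exact: VVU.
Qed.

Lemma right_entourage_nbhs : @nbhs G G = nbhs_ (right_entourage G).
Proof.
rewrite predeq2E => x A; split=> [Ax|[E [U U1 UE] EA]].
  exists [set xy | A (xy.2 * xy.1^-1 * x)]; last first.
    by move=> y /xsectionP /=; rewrite mulgVK.
  exists [set y | A (y * x)] => //.
  by apply: (@mulgr_continuous G x 1 A); rewrite /= mul1g.
apply: (filterS EA); apply: (@filterS _ _ _ [set y | U (y * x^-1)]).
  by move=> y Uy; apply/xsectionP/(UE (x, y)).
by apply: (@mulgr_continuous G x^-1 x U); rewrite /= mulgV.
Qed.

End group_uniformities.

Definition left_uniform (G : topologicalGroupType) : Type := G.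

HB.instance Definition _ (G : topologicalGroupType) :=
  Topological.copy (left_uniform G) G.
HB.instance Definition _ (G : topologicalGroupType) :=
  Nbhs_isUniform_mixin.Build (left_uniform G)
    (@left_entourage_filter G) (@left_entourage_refl G)
    (@left_entourage_inv G) (@left_entourage_split G)
    (@left_entourage_nbhs G).

Definition right_uniform (G : topologicalGroupType) : Type := G.

HB.instance Definition _ (G : topologicalGroupType) :=
  Topological.copy (right_uniform G) G.
HB.instance Definition _ (G : topologicalGroupType) :=
  Nbhs_isUniform_mixin.Build (right_uniform G)
    (@right_entourage_filter G) (@right_entourage_refl G)
    (@right_entourage_inv G) (@right_entourage_split G)
    (@right_entourage_nbhs G).

(* [sup_topology] applied to a family of uniform structures carries the
   supremum uniformity, generated by finite intersections of entourages. *)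
Definition two_sided_uniform (G : topologicalGroupType) : uniformType :=
  sup_topology (fun b : bool => if b then Uniform.class (left_uniform G)
                                else Uniform.class (right_uniform G)).

Lemma two_sided_entourageP (G : topologicalGroupType) (A : set (G * G)) :
  @entourage (two_sided_uniform G) A <->
  exists2 U, nbhs (1 : G) U &
    [set xy | U (xy.1^-1 * xy.2) /\ U (xy.2 * xy.1^-1)] `<=` A.
Proof.
split=> [[B [F _ <-] BA]|[U U1 UA]].
  pose S := filter_from (nbhs (1 : G))
    (fun U => [set xy : G * G | U (xy.1^-1 * xy.2) /\ U (xy.2 * xy.1^-1)]).
  have SF : Filter S.
    apply: filter_from_filter; first by exists setT; exact: filterT.
    by move=> U V U1 V1; exists (U `&` V);
      [exact: filterI|move=> p [[? ?] [? ?]]].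
  suff: S A by [].
  apply: (@filterS _ S _ _ _ BA).
  apply: filter_bigI => -[[b E] /= /asboolP ent] _.
  by case: b ent => -[V V1 VE]; exists V => // p [? ?]; exact: VE.
pose EL := [set xy : G * G | U (xy.1^-1 * xy.2)].
pose ER := [set xy : G * G | U (xy.2 * xy.1^-1)].
have L : @entourage (two_sided_uniform G) EL.
  eexists; last exact: subset_refl.
  have e : `[< @entourage (left_uniform G) EL >].
    by apply/asboolP; exists U.
  exists [fset (exist _ (true : {classic bool}, EL) e)]%fset.
    by move=> *; exact: in_setT.
  rewrite predeqE => p.
  by split=> [/(_ _ (fset11 _))//|? i]; rewrite /= inE => /eqP ->.
have R : @entourage (two_sided_uniform G) ER.
  eexists; last exact: subset_refl.
  have e : `[< @entourage (right_uniform G) ER >].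
    by apply/asboolP; exists U.
  exists [fset (exist _ (false : {classic bool}, ER) e)]%fset.
    by move=> *; exact: in_setT.
  rewrite predeqE => p.
  by split=> [/(_ _ (fset11 _))//|? i]; rewrite /= inE => /eqP ->.
have [_ FI FS] := @entourage_filter (two_sided_uniform G).
exact: FS UA (FI _ _ L R).
Qed.

Lemma cvg_two_sided (G : topologicalGroupType) (F : set_system G) (x : G) :
  Filter F -> F --> (x : two_sided_uniform G) <-> F --> x.
Proof. by move=> FF; rewrite cvg_sup; split=> [/(_ true)//|h []]. Qed.

(* Unlike the library's [completeType], this does not ask for a pointed type. *)
Definition uniformly_complete (U : uniformType) : Prop :=
  forall F : set_system U, ProperFilter F -> cauchy F ->
    exists x : U, F --> x.

Definition Raikov_complete (G : topologicalGroupType) : Prop :=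
  uniformly_complete (two_sided_uniform G).

(* Main.v *)
Require Import Defs.
From HB Require Import structures.
From mathcomp Require Import all_boot all_classical topology.

Set Implicit Arguments.
Unset Strict Implicit.
Unset Printing Implicit Defensive.

Local Open Scope classical_set_scope.
Local Open Scope group_scope.

(** Completeness implies $H$-closedness because a point $h$ of a quasitopological
group $H$ in the closure of the subgroup $G$ cuts out a fundamental filter on
$G$ ([fundamental_trace]).  Multiplication of $H$ is only separately
continuous, so closeness of $x, y \in G$ to $h$ does not at once make
$x^{-1}y$ small; but an intermediate $z \in G$, chosen close to $h$ after $x$
and $y$, makes both factors of $x^{-1}y = (x^{-1}z)(z^{-1}y)$ small, and then
the joint continuity of multiplication in $G$ applies.  The filter converges
in $G$, and its limit must be $h$.

Conversely $G$ is dense in its Raikov completion, which is a Hausdorff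
(quasi)topological group; so an $H$-closed $G$ equals its completion and every
fundamental filter converges.  The completion is built without any quotient.
Filters are multiplied by [F ** E], generated by the products $BC$ with
$B \in F$ and $C \in E$; this operation is associative.  With $N$ the
neighbourhood filter of the unit, call $F$ round when $N F = F = F N$.  Every
fundamental filter $F$ contains exactly one round fundamental filter, $N F N$,
so the round ones represent the points of the completion, the points of $G$
being the neighbourhood filters.  Roundness makes $N$ a unit, and together with
fundamentality it yields $F F^{-1} = N$.  The sets of all $F$ containing a
given $A$ form a base of the topology; with this base continuity of the
operations is immediate from the definition of the product.  *)

(** * Products of filters *)

Section filter_product.
Variable G : topologicalGroupType.
Implicit Types (F E D : set_system G) (x y : G).

Local Notation N := (nbhs (1 : G)).

Lemma nbhs1_mul3 U : N U ->
  exists2 V, N V & forall x y z, V x -> V y -> V z -> U (x * y * z).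
Proof.
have split2 W : N W -> exists2 V, N V & forall x y, V x -> V y -> W (x * y).
  move=> W1; have := @mulg_continuous G (1, 1) W.
  rewrite /= mulg1 => /(_ W1) [[V V'] /= [V1 V'1] VW].
  exists (V `&` V'); first exact: filterI.
  by move=> x y [Vx _] [_ Vy]; exact: (VW (x, y)).
move=> /split2[W W1 WU]; have [V V1 VW] := split2 _ W1.
exists (V `&` W); first exact: filterI.
by move=> x y z [Vx _] [Vy _] [_ Wz]; apply: WU => //; exact: VW.
Qed.

Lemma nbhs1_inv U : N U -> N [set x | U x^-1].
Proof. by move=> U1; apply: (@invg_continuous G 1 U); rewrite /= invg1. Qed.

Definition filter_mul F E : set_system G :=
  [set A | exists2 B, F B &
           exists2 C, E C & forall x y, B x -> C y -> A (x * y)].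

Definition filter_inv F : set_system G := [set A | F [set x | A x^-1]].

Local Notation "F ** E" := (filter_mul F E) (at level 40, left associativity).

Lemma filter_mulA F E D : F ** (E ** D) = F ** E ** D.
Proof.
apply/seteqP; split=> A.
  move=> [B FB [P [C EC [K DK CKP]] BPA]].
  exists [set z | exists x y, [/\ B x, C y & z = x * y]].
    by exists B => //; exists C => // x y Bx Cy; exists x, y.
  exists K => // _ z [x [y [Bx Cy ->]]] Kz; rewrite -mulgA.
  by apply: BPA => //; exact: CKP.
move=> [P [B FB [C EC BCP]] [K DK PKA]].
exists B => //; exists [set z | exists x y, [/\ C x, K y & z = x * y]].
  by exists C => //; exists K => // x y Cx Ky; exists x, y.
move=> x _ Bx [y [z [Cy Kz ->]]]; rewrite mulgA.
by apply: PKA => //; exact: BCP.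
Qed.

Lemma filter_invE F B : filter_inv F [set x | B x^-1] = F B.
Proof. by rewrite /filter_inv /=; under eq_set do rewrite invgK. Qed.

Lemma filter_invK F : filter_inv (filter_inv F) = F.
Proof.
rewrite /filter_inv predeqE => A /=.
by under eq_set do rewrite invgK.
Qed.

Lemma filter_invM F E :
  filter_inv (F ** E) = filter_inv E ** filter_inv F.
Proof.
apply/seteqP; split=> A [B FB [C EC BCA]].
  exists [set x | C x^-1]; first by rewrite filter_invE.
  exists [set x | B x^-1]; first by rewrite filter_invE.
  by move=> x y /= Cx By; rewrite -[x * y]invgK invgM; exact: BCA.
exists [set x | C x^-1] => //; exists [set x | B x^-1] => //.
by move=> x y /= Cx By; rewrite invgM; exact: BCA.
Qed.

Lemma filter_mul_nbhs x y : nbhs x ** nbhs y = nbhs (x * y).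
Proof.
apply/seteqP; split=> A => [[B Bx [C Cy BCA]]|].
  apply: (@filterS _ _ _ [set z | C (x^-1 * z)]).
    move=> z Cz; rewrite -[z](mulVKg x).
    by apply: BCA => //; exact: nbhs_singleton.
  by apply: (@mulgl_continuous G x^-1 (x * y) C); rewrite /= mulKg.
move=> /(@mulg_continuous G (x, y) A)[[B C] /= [Bx Cy] BCA].
by exists B => //; exists C => // u v Bu Cv; exact: (BCA (u, v)).
Qed.

Lemma filter_inv_nbhs1 : filter_inv N = N.
Proof.
apply/seteqP; split=> A /nbhs1_inv //.
by rewrite /=; under eq_set do rewrite invgK.
Qed.

Lemma filter_mul_proper F E :
  ProperFilter F -> ProperFilter E -> ProperFilter (F ** E).
Proof.
move=> FF FE; apply: Build_ProperFilter_ex.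
  move=> A [B FB [C EC BCA]].
  have [x Bx] := filter_ex FB; have [y Cy] := filter_ex EC.
  by exists (x * y); exact: BCA.
split.
- by exists setT; [exact: filterT|exists setT => //; exact: filterT].
- move=> A A' [B FB [C EC BCA]] [B' FB' [C' EC' BCA']].
  exists (B `&` B'); first exact: filterI.
  exists (C `&` C'); first exact: filterI.
  by move=> x y [Bx B'x] [Cy C'y]; split; [exact: BCA|exact: BCA'].
- move=> A A' AA' [B FB [C EC BCA]]; exists B => //; exists C => // x y Bx Cy.
  by apply: AA'; exact: BCA.
Qed.

Lemma filter_inv_proper F : ProperFilter F -> ProperFilter (filter_inv F).
Proof. by move=> FF; exact: (fmap_proper_filter (fun x => x^-1) FF). Qed.

(** * Fundamental filters *)

Definition fundamental F := forall U, N U -> exists2 B, F B &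
  forall x y, B x -> B y -> U (x^-1 * y) /\ U (y * x^-1).

Lemma two_sided_cauchyP F : Filter F ->
  cauchy (F : set_system (two_sided_uniform G)) <-> fundamental F.
Proof.
move=> FF; split=> [cF U U1|fF A /two_sided_entourageP[U U1 UA]].
  have : @entourage (two_sided_uniform G)
      [set xy | U (xy.1^-1 * xy.2) /\ U (xy.2 * xy.1^-1)].
    by apply/two_sided_entourageP; exists U.
  move=> /cF[[B C] /= [FB FC] BCU]; exists (B `&` C); first exact: filterI.
  by move=> x y [Bx _] [_ Cy]; exact: (BCU (x, y)).
have [B FB BU] := fF _ U1.
by exists (B, B) => // -[x y] [/= Bx By]; apply: UA; exact: BU.
Qed.

Lemma fundamental_nbhs x : fundamental (nbhs x).
Proof.
move=> U U1; have [V V1 VU] := nbhs1_mul3 U1.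
pose W := V `&` [set z | V z^-1].
have W1 : N W by apply: filterI => //; exact: nbhs1_inv.
exists [set y | W (x^-1 * y) /\ W (y * x^-1)].
  apply: filterI.
    by apply: (@mulgl_continuous G x^-1 x W); rewrite /= mulVg.
  by apply: (@mulgr_continuous G x^-1 x W); rewrite /= mulgV.
have V11 : V 1 by exact: nbhs_singleton.
move=> y z [[_ yl] [_ yr]] [[zl _] [zr _]]; split.
  have := VU _ _ _ yl zl V11.
  by rewrite mulg1 invgM invgK -mulgA mulVKg.
have := VU _ _ _ zr yr V11.
by rewrite mulg1 invgM invgK mulgA mulgVK.
Qed.

Lemma fundamental_inv F : fundamental F -> fundamental (filter_inv F).
Proof.
move=> fF U /fF[B FB BU]; exists [set x | B x^-1]; first by rewrite filter_invE.
by move=> x y /= Bx By; have [] := BU _ _ By Bx; rewrite invgK.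
Qed.

(** Conjugation is equicontinuous at the unit along a fundamental filter, since
$x = (x x_0^{-1}) x_0$ with $x x_0^{-1}$ small for one fixed $x_0$. *)
Lemma fundamental_conj F U : ProperFilter F -> fundamental F -> N U ->
  exists2 V, N V & exists2 B, F B & forall x v, B x -> V v -> U (x * v * x^-1).
Proof.
move=> FF fF U1; have [W W1 WU] := nbhs1_mul3 U1.
have [B FB BW] := fF _ W1; have [x0 Bx0] := filter_ex FB.
exists [set v | W (x0 * v * x0^-1)].
  apply: (@mulgl_continuous G x0 1 [set v | W (v * x0^-1)]).
  by apply: (@mulgr_continuous G x0^-1 _ W); rewrite /= mulg1 mulgV.
exists B => // x v Bx Wv.
have -> : x * v * x^-1 =
    (x * x0^-1) * (x0 * v * x0^-1) * (x0 * x^-1) by rewrite !mulgA !mulgVK.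
by apply: WU => //; [case: (BW _ _ Bx0 Bx)|case: (BW _ _ Bx Bx0)].
Qed.

(** In $(xy)^{-1}x'y' = (y^{-1}(x^{-1}x')y)(y^{-1}y')$ the conjugation by $y$
keeps the small factor $x^{-1}x'$ small. *)
Lemma fundamental_mul F E : ProperFilter F -> ProperFilter E ->
  fundamental F -> fundamental E -> fundamental (F ** E).
Proof.
move=> FF FE fF fE U U1; have [W W1 WU] := nbhs1_mul3 U1.
have W11 : W 1 by exact: nbhs_singleton.
have [V V1 [B FB BVW]] := fundamental_conj FF fF W1.
have [V' V'1 [C EC CVW]] :=
  fundamental_conj (filter_inv_proper FE) (fundamental_inv fE) W1.
have [B' FB' B'P] := fF _ (filterI W1 V'1).
have [C' EC' C'P] := fE _ (filterI W1 V1).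
exists [set z | exists x y,
    [/\ B x /\ B' x, C y^-1 /\ C' y & z = x * y]].
  exists (B `&` B'); first exact: filterI.
  exists ([set y | C y^-1] `&` C'); first exact: filterI.
  by move=> x y Bx Cy; exists x, y.
move=> _ _ [x [y [[Bx B'x] [Cy C'y] ->]]] [x' [y' [[Bx' B'x'] [Cy' C'y'] ->]]].
have [[_ Vx] [Wx _]] := B'P _ _ B'x B'x'.
have [[Wy _] [_ Vy]] := C'P _ _ C'y C'y'.
split.
  have := WU _ _ _ (CVW _ _ Cy Vx) Wy W11.
  by rewrite mulg1 invgK invgM !mulgA mulgK.
have := WU _ _ _ Wx (BVW _ _ Bx Vy) W11.
by rewrite mulg1 invgM !mulgA mulgVK.
Qed.

(** * The Raikov completion *)

(** Both equations are kept so that roundness passes to products and inverses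
by associativity alone. *)
Definition round F := N ** F = F /\ F ** N = F.

Lemma round_nbhs x : round (nbhs x).
Proof. by rewrite /round !filter_mul_nbhs mul1g mulg1. Qed.

Lemma round_mul F E : round F -> round E -> round (F ** E).
Proof.
by move=> [NF _] [_ EN]; split; rewrite ?filter_mulA ?NF // -filter_mulA EN.
Qed.

Lemma round_inv F : round F -> round (filter_inv F).
Proof.
move=> [NF FN]; split.
  by rewrite -{1}filter_inv_nbhs1 -filter_invM FN.
by rewrite -{1}filter_inv_nbhs1 -filter_invM NF.
Qed.

Lemma round_roundification F : round (N ** F ** N).
Proof.
have NN : N ** N = N by rewrite filter_mul_nbhs mulg1.
by split; rewrite ?filter_mulA ?NN // -!filter_mulA NN.
Qed.

(** Fundamentality gives $N \subset FF^{-1}$; for the converse, roundness gives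
$uD \subset B$ for all $u$ in some neighbourhood $U$ of the unit and one
$D \in F$, so that $U \subset BD^{-1}$. *)
Lemma filter_mulV F : ProperFilter F -> fundamental F -> round F ->
  F ** filter_inv F = N.
Proof.
move=> FF fF [NF _]; apply/seteqP; split=> A.
  move=> [B FB [C FC BCA]].
  have : (N ** F) (B `&` [set x | C x^-1]) by rewrite NF; exact: filterI.
  move=> [U U1 [D FD UD]]; have [d Dd] := filter_ex FD.
  have [_ Cd] := UD _ _ (nbhs_singleton U1) Dd; rewrite mul1g in Cd.
  apply: filterS U1 => u Uu; rewrite -[u](mulgK d).
  by apply: BCA => //; have [] := UD _ _ Uu Dd.
move=> /fF[B FB BA]; exists B => //; exists [set x | B x^-1].
  by rewrite filter_invE.
by move=> x y Bx By; have [] := BA _ _ By Bx; rewrite invgK.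
Qed.

(** Round filters are the smallest fundamental ones: a member $BU$ of $F = FN$
contains every small enough $C \in E$, since $C$ meets $B$.  Used in both
directions, this separates distinct points of the completion. *)
Lemma round_minimal F E : Filter E -> round F -> fundamental E -> F `#` E ->
  F `<=` E.
Proof.
move=> FE [_ FN] fE FEmeet A; rewrite -[X in X A -> _]FN => -[B FB [U U1 BUA]].
have [C EC CU] := fE _ U1; have [x [Bx Cx]] := FEmeet _ _ FB EC.
apply: filterS EC => y Cy; rewrite -[y](mulVKg x); apply: BUA => //.
by have [] := CU _ _ Cx Cy.
Qed.

End filter_product.

Record Raikov_completion (G : topologicalGroupType) := RaikovCompletion {
  completion_filter :> set G -> Prop;
  completion_proper : ProperFilter completion_filter;
  completion_fundamental : fundamental completion_filter;
  completion_round : round completion_filter }.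

Section completion.
Variable G : topologicalGroupType.
Local Notation H := (Raikov_completion G).
Implicit Types (x y z : H) (g : G).

#[local] Existing Instance completion_proper.

Lemma completion_eq x y : completion_filter x = completion_filter y -> x = y.
Proof.
case: x y => [F pF fF rF] [E pE fE rE] /= FE; case: _ / FE in pE fE rE *.
by congr RaikovCompletion; exact: Prop_irrelevance.
Qed.

HB.instance Definition _ := gen_eqMixin H.
HB.instance Definition _ := gen_choiceMixin H.

Definition completion_nbhs g : H :=
  RaikovCompletion (nbhs_pfilter g) (fundamental_nbhs g) (round_nbhs g).

Definition completion_mul x y : H := RaikovCompletion
  (filter_mul_proper (completion_proper x) (completion_proper y))
  (fundamental_mul (completion_proper x) (completion_proper y)
     (@completion_fundamental _ x) (@completion_fundamental _ y))
  (round_mul (completion_round x) (completion_round y)).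

Definition completion_inv x : H := RaikovCompletion
  (filter_inv_proper (completion_proper x))
  (fundamental_inv (@completion_fundamental _ x))
  (round_inv (completion_round x)).

Let mulA : associative completion_mul.
Proof. by move=> x y z; apply: completion_eq; exact: filter_mulA. Qed.

Let mul1x : left_id (completion_nbhs 1) completion_mul.
Proof. by move=> x; apply: completion_eq; case: (completion_round x). Qed.

Let mulx1 : right_id (completion_nbhs 1) completion_mul.
Proof. by move=> x; apply: completion_eq; case: (completion_round x). Qed.

Let mulxV : right_inverse (completion_nbhs 1) completion_inv completion_mul.
Proof.
move=> x; apply: completion_eq; apply: filter_mulV.
- exact: completion_fundamental.
- exact: completion_round.
Qed.

Let mulVx : left_inverse (completion_nbhs 1) completion_inv completion_mul.
Proof.
move=> x; have invK : completion_inv (completion_inv x) = x.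
  by apply: completion_eq; exact: filter_invK.
by rewrite -[X in completion_mul _ X]invK mulxV.
Qed.

HB.instance Definition _ := isGroup.Build H mulA mul1x mulx1 mulVx mulxV.

(** The sets $\{y \mid A \in y\}$ are open because the witness $A$ does not
depend on the point of the set. *)
Let basic_nbhs x : set_system H :=
  [set O | exists2 A, x A & forall y, y A -> O y].

HB.instance Definition _ := hasNbhs.Build H basic_nbhs.

Let basic_nbhs_filter x : ProperFilter (nbhs x).
Proof.
apply: Build_ProperFilter_ex => [O [A xA AO]|]; first by exists x; exact: AO.
split.
- by exists setT => //; exact: filterT.
- move=> O O' [A xA AO] [A' xA' AO']; exists (A `&` A'); first exact: filterI.
  move=> y yAA'; split; [apply: AO|apply: AO']; apply: filterS yAA'.
  + exact: subIsetl.
  + exact: subIsetr.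
- by move=> O O' OO' [A xA AO]; exists A => // y /AO /OO'.
Qed.

Let basic_nbhs_singleton x (O : set H) : nbhs x O -> O x.
Proof. by move=> [A xA]; exact. Qed.

Let basic_nbhs_nbhs x (O : set H) : nbhs x O -> nbhs x (nbhs^~ O).
Proof. by move=> [A xA AO]; exists A => // y yA; exists A. Qed.

HB.instance Definition _ := Nbhs_isNbhsTopological.Build H
  basic_nbhs_filter basic_nbhs_singleton basic_nbhs_nbhs.

Let mulgl_cts x : continuous (fun y : H => x * y).
Proof.
move=> y O [A [B xB [C yC BCA]] AO]; exists C => // z zC.
by apply: AO; exists B => //; exists C.
Qed.

Let mulgr_cts x : continuous (fun y : H => y * x).
Proof.
move=> y O [A [B yB [C xC BCA]] AO]; exists B => // z zB.
by apply: AO; exists B => //; exists C.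
Qed.

Let invg_cts : continuous (fun x : H => x^-1).
Proof.
by move=> x O [A xA AO]; exists [set g | A g^-1] => // y yA; exact: AO.
Qed.

HB.instance Definition _ :=
  isQuasitopologicalGroup.Build H mulgl_cts mulgr_cts invg_cts.

Lemma completion_hausdorff : hausdorff_space H.
Proof.
have meet x y : cluster (nbhs x) y -> x `#` y.
  move=> xy A B xA yB.
  have [||z [zA zB]] := xy [set z : H | z A] [set z : H | z B].
  - by exists A.
  - by exists B.
  exact: filter_ex (filterI zA zB).
move=> x y /meet xy; apply: completion_eq; apply/seteqP; split.
  apply: round_minimal => //; first exact: completion_round.
  exact: completion_fundamental.
apply: round_minimal; first exact: completion_round.
  exact: completion_fundamental.
by rewrite meetsC.
Qed.

Let completion_nbhsM : {morph completion_nbhs : g g' / g * g'}.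
Proof.
by move=> g g'; apply: completion_eq; rewrite /= filter_mul_nbhs.
Qed.

HB.instance Definition _ :=
  isMultiplicative.Build G H completion_nbhs completion_nbhsM.

Lemma completion_nbhs_embedding :
  hausdorff_space G -> subgroup_embedding completion_nbhs.
Proof.
move=> hG; split.
  move=> g g' /(congr1 (@completion_filter G)) /= gg'; apply: hG.
  by rewrite gg' => A B gA gB; exact: filter_ex (filterI gA gB).
apply/seteqP; split=> [V oV|_ [O oO <-]].
  exists [set x : H | x V].
    by rewrite openE => x xV; exists V.
  apply/seteqP; split=> g /=; first exact: nbhs_singleton.
  by move=> Vg; exact: open_nbhs_nbhs.
move: oO; rewrite !openE => oO g /oO[A gA AO].
apply: filterS (nbhs_interior gA) => g' g'A; exact: AO.
Qed.

(** Roundness thickens a member $B$ of [x] to a member $BU$, which is a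
neighbourhood of every point of $B$. *)
Lemma completion_nbhs_dense : closure (range completion_nbhs) = setT.
Proof.
apply/seteqP; split=> // x _ O [A xA AO].
move: xA; have [_ <-] := completion_round x => -[B xB [U U1 BUA]].
have [g Bg] := filter_ex xB.
exists (completion_nbhs g); split; first by exists g.
apply: AO; apply: (@filterS _ _ _ [set y | U (g^-1 * y)]).
  by move=> y Uy; rewrite -[y](mulVKg g); exact: BUA.
by apply: (@mulgl_continuous G g^-1 g U); rewrite /= mulVg.
Qed.

End completion.

(** A fundamental filter $F$ contains the point $NFN$ of the completion; when
that point is the neighbourhood filter of $g$, this says that $F$ converges to
$g$. *)
Lemma Hclosed_Raikov_complete (G : topologicalGroupType) :
  hausdorff_space G -> Hclosed_quasitopological G -> Raikov_complete G.
Proof.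
move=> hG cG F FF /two_sided_cauchyP fF.
have pN := nbhs_pfilter (1 : G); have fN := fundamental_nbhs (1 : G).
have pNF := filter_mul_proper pN FF.
have fNF := fundamental_mul pN FF fN fF.
pose x := RaikovCompletion (filter_mul_proper pNF pN)
  (fundamental_mul pNF pN fNF fN) (round_roundification F).
have : range (@completion_nbhs G) x.
  have /closure_id -> := cG _ _ (@completion_hausdorff G)
    (completion_nbhs_embedding hG).
  by rewrite completion_nbhs_dense.
move=> [g _ /(congr1 (@completion_filter G)) /= gF]; exists g.
apply/cvg_two_sided => A; rewrite gF => -[B [U U1 [C FC UCB]] [V V1 BVA]].
apply: filterS FC => y Cy; rewrite -[y]mulg1 -[y]mul1g.
apply: BVA; last exact: nbhs_singleton.
by apply: UCB => //; exact: nbhs_singleton.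
Qed.

(** * Adherent points of a subgroup *)

Section adherent.
Variables (G : topologicalGroupType) (H : quasitopologicalGroupType).
Variable f : {multiplicative G -> H}.

Let morph1 : f 1 = 1.
Proof. by apply: (mulgI (f 1)); rewrite -gmulfM !mulg1. Qed.

Let morphV (x : G) : f x^-1 = (f x)^-1.
Proof. by apply: (mulgI (f x)); rewrite -gmulfM !mulgV morph1. Qed.

Hypothesis femb : subgroup_embedding f.

Definition trace_filter (h : H) : set_system G :=
  [set A | exists2 V, nbhs h V & f @^-1` V `<=` A].

Lemma trace_proper h : closure (range f) h -> ProperFilter (trace_filter h).
Proof.
move=> clh; apply: Build_ProperFilter_ex.
  move=> A [V /clh[_ [[g _ <-] Vg]] VA]; exists g; exact: VA.
split.
- by exists setT => //; exact: filterT.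
- move=> A B [V hV VA] [W hW WB]; exists (V `&` W); first exact: filterI.
  by move=> g [Vg Wg]; split; [exact: VA|exact: WB].
- by move=> A B AB [V hV VA]; exists V => // g /VA /AB.
Qed.

Lemma nbhs_embedding (g : G) (A : set G) :
  nbhs g A <-> trace_filter (f g) A.
Proof.
have [_ opE] := femb; split=> [|[V /= fgV VA]].
  rewrite nbhsE => -[O [oO Og] OA]; move: oO; rewrite opE => -[V oV VO].
  exists V; first by apply: open_nbhs_nbhs; split => //; rewrite -VO in Og.
  by rewrite VO.
move: fgV; rewrite nbhsE => -[O [oO Og] OV].
rewrite nbhsE; exists (f @^-1` O); last by move=> x /OV /VA.
by split=> //; rewrite opE; exists O.
Qed.

(** The intermediate point $z \in G$ is taken close to $h$ depending on $x$ and
$y$: separate continuity suffices to make $x^{-1}z$, $zx^{-1}$, $y^{-1}z$ and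
$zy^{-1}$ small once $x^{-1}h$, $hx^{-1}$, $y^{-1}h$ and $hy^{-1}$ are. *)
Lemma fundamental_trace h :
  closure (range f) h -> fundamental (trace_filter h).
Proof.
move=> clh U U1; have [W W1 WU] := nbhs1_mul3 U1.
have W11 : W 1 by exact: nbhs_singleton.
(* The inverses are controlled as well, to pass from $y^{-1}z$ to $z^{-1}y$. *)
have [V0] := (nbhs_embedding _ _).1 (filterI W1 (nbhs1_inv W1)).
rewrite morph1 nbhsE => -[V [oV V1] VV0] V0W.
have {VV0 V0W}VW g : V (f g) -> W g /\ W g^-1 by move=> /VV0 /V0W.
pose near_h x z := V (x^-1 * z) /\ V (z * x^-1).
have near_right x : near_h x h -> nbhs h (near_h x).
  move=> [lx rx]; apply: filterI.
    by apply: (@mulgl_continuous H x^-1 h V); exact: open_nbhs_nbhs.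
  by apply: (@mulgr_continuous H x^-1 h V); exact: open_nbhs_nbhs.
have near_left : nbhs h [set x | near_h x h].
  apply: filterI.
    apply: (@invg_continuous H h [set x | V (x * h)]).
    apply: (@mulgr_continuous H h h^-1 V) => /=.
    by apply: open_nbhs_nbhs; rewrite mulVg.
  apply: (@invg_continuous H h [set x | V (h * x)]).
  apply: (@mulgl_continuous H h h^-1 V) => /=.
  by apply: open_nbhs_nbhs; rewrite mulgV.
exists (f @^-1` [set x | near_h x h]); first by exists [set x | near_h x h].
move=> x y /near_right hx /near_right hy.
have [_ [[z _ <-]]] := clh _ (filterI hx hy).
rewrite /near_h /= -!morphV -!gmulfM => -[[/VW[xz _] /VW[zx _]]].
move=> [/VW[_ yz] /VW[_ zy]]; split.
  have := WU _ _ _ xz yz W11.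
  by rewrite mulg1 invgM invgK -mulgA mulVKg.
have := WU _ _ _ zy zx W11.
by rewrite mulg1 invgM invgK mulgA mulgVK.
Qed.

End adherent.

(** The trace on $G$ of the neighbourhoods of an adherent point $h$ converges to
some $g \in G$, and $h$ is then not separated from $g$. *)
Lemma Raikov_complete_Hclosed (G : topologicalGroupType) :
  Raikov_complete G -> Hclosed_quasitopological G.
Proof.
move=> cG H f hH femb h clh.
have Fp := trace_proper clh.
have [|g /cvg_two_sided gF] := cG (trace_filter f h) Fp.
  apply/two_sided_cauchyP; exact: fundamental_trace.
exists g => //; apply: hH => A B gA hB.
have /gF : nbhs (g : G) (f @^-1` A) by apply/(nbhs_embedding femb); exists A.
move=> [V hV VA]; have [_ [[x _ <-] [Vx Bx]]] := clh _ (filterI hV hB).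
by exists (f x); split => //; exact: VA.
Qed.

Theorem corollary9 (G : topologicalGroupType) (hG : hausdorff_space G) :
  Hclosed_quasitopological G <-> Raikov_complete G.
Proof.
by split; [exact: Hclosed_Raikov_complete|exact: Raikov_complete_Hclosed].
Qed.
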